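(* Let $y_1,y_2,\dots$ be i.i.d. $\mathcal{N}(\phi_0,1)$ with true value $\phi_0=0$, and let the prior on $\phi$ be the HTHS prior or the HTHS+ prior (defined in the context). Let $R_n(0)$ be the Cesàro-average Bayes predictive risk (defined in the context). Then for any $a>0$ there is a constant $C_a^0>0$ such that $$R_n(0)\le a\,\frac{\log n}{n}+\frac{1}{n}\left(1+\frac{1}{a\,C_a^0}\right).$$
   Context: The HTHS prior on $\phi\in\mathbb{R}$: $\phi\mid\gamma\sim\mathcal{N}(0,1/\gamma)$, with $\gamma$ having density $\frac{1}{\gamma\left((\log\gamma)^2+\pi^2\right)}$ on $(0,\infty)$. The HTHS+ prior: $\phi\mid\gamma\sim\mathcal{N}(0,1/\gamma)$ with $\gamma$ having density $\frac{2}{\gamma\left((\log\gamma)^2+4\pi^2\right)}$ on $(0,\infty)$. Let $f(y\mid\phi)$ denote the $\mathcal{N}(\phi,1)$ density and $L(f_1,f_2)=\int f_1\log(f_1/f_2)$ the Kullback–Leibler divergence. For $j\ge1$, let $\hat f_j(y)=\int f(y\mid\phi)\,\pi(\mathrm{d}\phi\mid y_1,\dots,y_{j-1})$ be the Bayes posterior predictive density after $j-1$ observations (with $\hat f_1$ the prior predictive). The Cesàro-average Bayes predictive risk is $R_n(\phi_0)=\frac{1}{n}\sum_{j=1}^n \mathbb{E}_{\phi_0}\big[L(f(\cdot\mid\phi_0),\hat f_j)\big]$. *)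

(* Defs.v *)
From HB Require Import structures.
From mathcomp Require Import all_boot all_order all_algebra.
From mathcomp Require Import all_classical all_reals all_analysis.
Set Implicit Arguments. Unset Strict Implicit. Unset Printing Implicit Defensive.
Import Order.TTheory GRing.Theory Num.Theory.
Import numFieldNormedType.Exports.
Local Open Scope classical_set_scope.
Local Open Scope ring_scope.

Section HTHS.
Variable R : realType.
Local Notation mu := (@lebesgue_measure R).

Definition gauss (m v x : R) : R :=
  expR (- ((x - m) ^+ 2) / (2 * v)) / Num.sqrt (2 * pi * v).

(* density of gamma under the HTHS prior, on (0, +oo) *)
Definition hths_dens (g : R) : R := 1 / (g * ((ln g) ^+ 2 + pi ^+ 2)).
(* density of gamma under the HTHS+ prior, on (0, +oo) *)
Definition hthsp_dens (g : R) : R := 2 / (g * ((ln g) ^+ 2 + 4 * pi ^+ 2)).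

(* marginal prior density of phi: phi | gamma ~ N(0, 1/gamma), gamma ~ h *)
Definition prior_dens (h : R -> R) (phi : R) : \bar R :=
  (\int[mu]_(g in [set g : R | (0 < g)%R]) (gauss 0 g^-1 phi * h g)%:E)%E.

Definition lik (s : seq R) (phi : R) : R := \prod_(y <- s) gauss phi 1 y.

(* Bayes posterior predictive density after observing s:
   int f(y|phi) pi(dphi | s) = int f(y|phi) lik(s|phi) pi(phi) dphi
                               / int lik(s|phi) pi(phi) dphi *)
Definition post_pred (h : R -> R) (s : seq R) (y : R) : R :=
  fine (\int[mu]_phi ((gauss phi 1 y * lik s phi)%:E * prior_dens h phi))%E /
  fine (\int[mu]_phi ((lik s phi)%:E * prior_dens h phi))%E.

Definition KL (f1 f2 : R -> R) : \bar R :=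
  (\int[mu]_x (f1 x * ln (f1 x / f2 x))%:E)%E.

(* expectation of F(y_1, ..., y_k) for y_i i.i.d. N(phi0, 1),
   written as an iterated (Tonelli) integral *)
Fixpoint iid_exp (phi0 : R) (k : nat) (F : seq R -> \bar R) : \bar R :=
  match k with
  | 0%N => F [::]
  | k'.+1 => (\int[mu]_y ((gauss phi0 1 y)%:E *
                          iid_exp phi0 k' (fun s => F (y :: s))))%E
  end.

(* Cesaro-average Bayes predictive risk
   R_n(phi0) = (1/n) sum_{j=1}^n E_phi0 [ L(f(.|phi0), hat f_j) ],
   hat f_j being the posterior predictive after j-1 observations *)
Definition cesaro_risk (h : R -> R) (phi0 : R) (n : nat) : \bar R :=
  ((n%:R^-1)%:E *
   \sum_(j < n) iid_exp phi0 j (fun s => KL (gauss phi0 1) (post_pred h s)))%E.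

End HTHS.

(* Main.v *)
Require Import Defs.
From HB Require Import structures.
From mathcomp Require Import all_boot all_order all_algebra.
From mathcomp Require Import all_classical all_reals all_analysis.
From mathcomp Require Import measurable_realfun.
From mathcomp Require Import ring lra.
Set Implicit Arguments. Unset Strict Implicit. Unset Printing Implicit Defensive.
Import Order.TTheory GRing.Theory Num.Theory.
Import numFieldNormedType.Exports.
Local Open Scope classical_set_scope.
Local Open Scope ring_scope.

(* Completing the square in phi shows that the marginal likelihood of a sample
   s is [lik s 0] times a Bayes factor W(k, S) depending only on the sample size
   k and the sum S of the observations, namely the mean over gamma of
   sqrt(gamma / (gamma + k)) * exp(S^2 / (2 (gamma + k))).
   Hence the j-th predictive risk is E ln W(j, S_j) - E ln W(j+1, S_(j+1)), and
   the cumulative risk telescopes to ln W(0, 0) - E ln W(n, S_n), which is at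
   most ln W(0, 0) - ln W(n, 0) since W(n, .) is minimal at 0. The precisions
   gamma in [n, 2n] alone give W(n, 0) >= const / (ln(2n)^2 + q): the prior
   density decays only logarithmically faster than 1 / gamma, and
   ln(2n)^2 + q = O(n^a) for every a > 0. *)

(** * Gaussian densities, exponential tilting and the likelihood of a sample *)

Section gaussian.
Variable R : realType.
Local Notation mu := (@lebesgue_measure R).

Lemma gauss_normal_pdf (m v : R) : 0 < v ->
  gauss m v = normal_pdf m (Num.sqrt v).
Proof.
move=> v0; have sv0 : Num.sqrt v != 0 by rewrite gt_eqF// sqrtr_gt0.
apply/funext => x.
rewrite normal_pdfE// /gauss /normal_peak /normal_fun sqr_sqrtr ?ltW// mulrC.
by congr (_^-1 * expR (_ * _^-1)); [congr Num.sqrt|]; rewrite -mulr_natr; ring.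
Qed.

Lemma gauss_ge0 (m v x : R) : 0 <= gauss m v x.
Proof. by rewrite mulr_ge0 ?expR_ge0 ?invr_ge0 ?sqrtr_ge0. Qed.

Lemma gauss_gt0 (m v x : R) : 0 < v -> 0 < gauss m v x.
Proof.
move=> v0; rewrite mulr_gt0 ?expR_gt0// invr_gt0 sqrtr_gt0.
by rewrite !mulr_gt0// pi_gt0.
Qed.

Lemma measurable_gauss (m v : R) : measurable_fun setT (gauss m v).
Proof.
apply: measurable_funM => //; apply: measurableT_comp => //.
apply: measurable_funM => //; apply: measurableT_comp => //.
by apply: measurable_funX; exact: measurable_funB.
Qed.

Lemma integral_gauss (m v : R) : 0 < v -> (\int[mu]_x (gauss m v x)%:E = 1)%E.
Proof. by move=> v0; rewrite gauss_normal_pdf// integral_normal_pdf. Qed.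

Lemma integrable_gauss (m v : R) : 0 < v ->
  mu.-integrable setT (fun x => (gauss m v x)%:E).
Proof. by move=> v0; rewrite gauss_normal_pdf//; exact: integrable_normal_pdf. Qed.

(** Exponential tilting only moves the mean to [t], up to the moment generating factor; exponentials
    thus have closed Gaussian integrals. *)
Lemma gauss_expR (t x : R) :
  gauss 0 1 x * expR (t * x) = expR (t ^+ 2 / 2) * gauss t 1 x.
Proof.
rewrite /gauss mulrAC -expRD mulrA -expRD; congr (expR _ / _).
by field.
Qed.

(** Conjugacy at a fixed precision [g]: after [k] observations of sum [S] the posterior is Gaussian
    with mean [S / (g + k)] and precision [g + k]. The factor in front collects what does not depend
    on [x]. *)
Lemma gauss_complete_square (g k S x : R) : 0 < g -> 0 <= k ->
  expR (x * S - k * x ^+ 2 / 2) * gauss 0 g^-1 x =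
  Num.sqrt (g / (g + k)) * expR (S ^+ 2 / (2 * (g + k))) *
  gauss (S / (g + k)) (g + k)^-1 x.
Proof.
move=> g0 k0; have gk0 : 0 < g + k by lra.
have p0 := @pi_gt0 R.
have peak : (Num.sqrt (2 * pi * g^-1))^-1 =
    Num.sqrt (g / (g + k)) * (Num.sqrt (2 * pi * (g + k)^-1))^-1.
  rewrite -!sqrtrV ?mulr_ge0 ?invr_ge0 ?pi_ge0 ?ltW//.
  rewrite -sqrtrM ?mulr_ge0 ?invr_ge0 ?ltW//.
  by congr Num.sqrt; move: pi p0 => p p0; field; rewrite !gt_eqF.
rewrite /gauss peak.
set A := expR (x * S - _); set B := expR (- (x - 0) ^+ 2 / _).
set D := expR (S ^+ 2 / _); set E := expR (- (x - _) ^+ 2 / _).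
have AB : A * B = D * E.
  rewrite -!expRD; congr expR; field.
  by rewrite !gt_eqF.
transitivity (A * B * (Num.sqrt (g / (g + k)) / Num.sqrt (2 * pi / (g + k)))).
  ring.
by rewrite AB; ring.
Qed.

(** Each observation [y] contributes the density ratio [expR (x * y - x ^+ 2 / 2)], so size and sum
    are sufficient statistics. *)
Lemma lik_factor (s : seq R) (x : R) :
  lik s x = lik s 0 * expR (x * \sum_(y <- s) y - (size s)%:R * x ^+ 2 / 2).
Proof.
rewrite /lik; elim: s => [|y s IH].
  by rewrite !big_nil mulr0 mul0r mul0r subr0 expR0 mulr1.
have sz : (size s).+1%:R = (size s)%:R + 1 :> R by rewrite natr1.
rewrite !big_cons IH /= sz /gauss.
set E := (\prod_(_ <- _) _); set S := \sum_(_ <- _) _.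
set z := (size s)%:R; set c := Num.sqrt _.
have -> : expR (x * (y + S) - (z + 1) * x ^+ 2 / 2) =
  expR (x * y - x ^+ 2 / 2) * expR (x * S - z * x ^+ 2 / 2).
  by rewrite -expRD; congr expR; ring.
have -> : expR (- (y - x) ^+ 2 / (2 * 1)) =
  expR (- (y - 0) ^+ 2 / (2 * 1)) * expR (x * y - x ^+ 2 / 2).
  by rewrite -expRD; congr expR; field.
ring.
Qed.

Lemma lik_gt0 (s : seq R) (x : R) : 0 < lik s x.
Proof. by rewrite /lik prodr_gt0// => y _; exact: gauss_gt0. Qed.

End gaussian.

(** * Averaging over one more observation, and functions of exponential growth *)

Section smoothing.
Variable R : realType.
Local Notation mu := (@lebesgue_measure R).

(** Convolution with the standard Gaussian: the mean, under [phi = 0], of a function of the running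
    sum after one more observation. *)
Definition smooth (F : R -> R) (S : R) : R :=
  fine (\int[mu]_y (gauss 0 1 y * F (S + y))%:E)%E.

(** A class that contains the log Bayes factors, is stable under [smooth], and has finite Gaussian
    integrals. *)
Definition exp_growth (F : R -> R) : Prop :=
  measurable_fun setT F /\
  exists A, forall S, `|F S| <= A * (expR S + expR (- S)).

(** Tilting by 1 and by -1 turns the dominating function into a combination of Gaussian densities
    centred at 1 and -1. *)
Let smooth_dom (A S : R) :
  (fun y => (gauss 0 1 y * (A * (expR (S + y) + expR (- (S + y)))))%:E) =
  (fun y => (A * expR 2^-1 * expR S)%:E * (gauss 1 1 y)%:E +
            (A * expR 2^-1 * expR (- S))%:E * (gauss (-1) 1 y)%:E)%E.
Proof.
apply/funext => y; rewrite -!EFinM -EFinD; congr EFin.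
rewrite opprD !expRD.
have := gauss_expR 1 y; rewrite expr1n !mul1r => e1.
have := gauss_expR (-1) y; rewrite sqrrN expr1n mul1r mulN1r => e2.
transitivity (A * expR S * (gauss 0 1 y * expR y) +
  A * expR (- S) * (gauss 0 1 y * expR (- y))); first by ring.
by rewrite e1 e2; ring.
Qed.

Let integrable_smooth_dom (A S : R) :
  mu.-integrable setT
    (fun y => (gauss 0 1 y * (A * (expR (S + y) + expR (- (S + y)))))%:E).
Proof.
rewrite smooth_dom; apply: integrableD => //; apply: integrableZl => //;
  exact: integrable_gauss.
Qed.

Let integral_smooth_dom (A S : R) :
  (\int[mu]_y (gauss 0 1 y * (A * (expR (S + y) + expR (- (S + y)))))%:E =
   (A * expR 2^-1 * (expR S + expR (- S)))%:E)%E.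
Proof.
rewrite smooth_dom integralD//=; first last.
- by apply: integrableZl => //; exact: integrable_gauss.
- by apply: integrableZl => //; exact: integrable_gauss.
rewrite !integralZl//; try exact: integrable_gauss.
by rewrite !integral_gauss// !mule1 -EFinD mulrDr.
Qed.

Lemma measurable_gauss_shift (F : R -> R) (S : R) : measurable_fun setT F ->
  measurable_fun setT (fun y => gauss 0 1 y * F (S + y)).
Proof.
move=> mF; apply: measurable_funM; first exact: measurable_gauss.
by apply: measurableT_comp => //; exact: measurable_funD.
Qed.

Lemma integrable_smooth F S : exp_growth F ->
  mu.-integrable setT (fun y => (gauss 0 1 y * F (S + y))%:E).
Proof.
move=> [mF [A FA]].
apply: (le_integrable _ _ _ (integrable_smooth_dom A S)) => //.
  by apply/measurable_EFinP; exact: measurable_gauss_shift.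
move=> y _; rewrite !abse_EFin lee_fin !normrM ler_wpM2l//.
by rewrite -normrM; apply: (le_trans (FA _)); exact: ler_norm.
Qed.

Lemma smoothE F S : exp_growth F ->
  (\int[mu]_y (gauss 0 1 y * F (S + y))%:E)%E = (smooth F S)%:E.
Proof.
move=> gF; rewrite /smooth fineK//.
by apply: integrable_fin_num => //; exact: integrable_smooth.
Qed.

Lemma exp_growth_cst (c : R) : exp_growth (cst c).
Proof.
split; first exact: measurable_cst.
exists `|c| => S /=; rewrite ler_peMr//.
by have := expR_ge1Dx S; have := expR_ge1Dx (- S); lra.
Qed.

Lemma exp_growthB F G : exp_growth F -> exp_growth G ->
  exp_growth (fun S => F S - G S).
Proof.
move=> [mF [A FA]] [mG [B GB]]; split; first exact: measurable_funB.
exists (A + B) => S; rewrite mulrDl.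
by rewrite (le_trans (ler_normB _ _))// lerD.
Qed.

Lemma smoothB F G S : exp_growth F -> exp_growth G ->
  smooth (fun S => F S - G S) S = smooth F S - smooth G S.
Proof.
move=> gF gG; apply: EFin_inj; rewrite -smoothE; last exact: exp_growthB.
rewrite EFinB -!smoothE// -integralB//=; try exact: integrable_smooth.
by apply: eq_integral => y _; rewrite -EFinB mulrBr.
Qed.

Lemma smooth_cst (c S : R) : smooth (cst c) S = c.
Proof.
rewrite /smooth /=.
under eq_integral do rewrite mulrC EFinM.
by rewrite integralZl//; [rewrite integral_gauss// mule1|exact: integrable_gauss].
Qed.

Lemma smooth_le F G S : exp_growth F -> exp_growth G ->
  (forall x, F x <= G x) -> smooth F S <= smooth G S.
Proof.
move=> gF gG FG; rewrite -lee_fin -!smoothE//.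
apply: le_integral => //; try exact: integrable_smooth.
by move=> y _; rewrite lee_fin ler_wpM2l// gauss_ge0.
Qed.

(** The function [expR S + expR (- S)] is an eigenfunction of [smooth] with eigenvalue [expR 2^-1],
    so only the constant in the growth bound changes. *)
Lemma exp_growth_smooth F : exp_growth F -> exp_growth (smooth F).
Proof.
move=> gF; have [mF [A FA]] := gF; split.
  pose f (z : R * R) : \bar R := (gauss 0 1 z.2 * F (z.1 + z.2))%:E.
  have mf : measurable_fun setT f.
    apply/measurable_EFinP => /=; apply: measurable_funM.
      by apply: measurableT_comp => //; exact: measurable_gauss.
    apply: measurableT_comp => //.
    by apply: measurable_funD; [exact: measurable_fst|exact: measurable_snd].
  apply: measurableT_comp => //.
  (* Tonelli measurability concerns nonnegative integrands, hence the split into positive and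
     negative parts. *)
  rewrite (_ : (fun S => _) = fubini_F mu f^\+%E \- fubini_F mu f^\-%E)%E; last first.
    apply/funext => S; rewrite integralE.
    by congr (_ - _)%E; apply: eq_integral => y _; rewrite ?funeposE ?funenegE.
  apply: emeasurable_funB; apply: measurable_fun_fubini_tonelli_F => //.
  - exact: measurable_funepos.
  - exact: measurable_funeneg.
exists (A * expR 2^-1) => S.
rewrite -lee_fin -integral_smooth_dom.
have -> : (`|smooth F S|%:E = `| \int[mu]_y (gauss 0 1 y * F (S + y))%:E |)%E.
  by rewrite smoothE.
apply: (le_trans (le_abse_integral _ _ _)) => //.
  by apply/measurable_EFinP; exact: measurable_gauss_shift.
apply: ge0_le_integral => //.
- apply/measurable_EFinP/measurableT_comp => //; exact: measurable_gauss_shift.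
- have /integrableP[] := integrable_smooth_dom A S; by [].
- move=> y _; rewrite abse_EFin lee_fin normrM ger0_norm ?gauss_ge0//.
  by rewrite ler_wpM2l ?gauss_ge0.
Qed.

Lemma exp_growth_iter k F : exp_growth F -> exp_growth (iter k smooth F).
Proof. by move=> gF; elim: k => [//|k]; exact: exp_growth_smooth. Qed.

Lemma iter_smoothB k F G S : exp_growth F -> exp_growth G ->
  iter k smooth (fun S => F S - G S) S = iter k smooth F S - iter k smooth G S.
Proof.
move=> gF gG; elim: k S => [//|k IH] S; rewrite !iterS.
have -> : iter k smooth (fun S => F S - G S) =
    (fun S => iter k smooth F S - iter k smooth G S) by apply/funext.
by rewrite smoothB//; exact: exp_growth_iter.
Qed.

(** [smooth] is monotone and fixes constants. *)
Lemma iter_smooth_ge k F c S : exp_growth F -> (forall x, c <= F x) ->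
  c <= iter k smooth F S.
Proof.
move=> gF cF; elim: k S => [//|k IH] S; rewrite iterS.
rewrite -[leLHS](smooth_cst c S); apply: smooth_le => //.
- exact: exp_growth_cst.
- exact: exp_growth_iter.
Qed.

Lemma iid_exp_eq k (F G : seq R -> \bar R) :
  (forall s, size s = k -> F s = G s) -> iid_exp 0 k F = iid_exp 0 k G.
Proof.
elim: k F G => [|k IH] F G FG /=; first exact: FG.
apply: eq_integral => y _; congr (_ * _)%E; apply: IH => s sk.
by apply: FG; rewrite /= sk.
Qed.

(** The offset [S] carries the observations already drawn, which lets the induction peel off one
    observation at a time. *)
Lemma iid_exp_sum k F S : exp_growth F ->
  iid_exp 0 k (fun s => (F (S + \sum_(y <- s) y))%:E) = (iter k smooth F S)%:E.
Proof.
move=> gF; elim: k S => [|k IH] S /=; first by rewrite big_nil addr0.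
rewrite -smoothE; last exact: exp_growth_iter.
apply: eq_integral => y _; rewrite [in RHS]EFinM; congr (_ * _)%E.
apply: etrans (IH _).
by apply: iid_exp_eq => s _; rewrite big_cons addrA.
Qed.

End smoothing.

(** * Measurability of inverses of positive functions and of square roots *)

Section positive_measurability.
Context {d : measure_display} {T : measurableType d} {R : realType}.
Implicit Types f : T -> R.

Lemma measurable_fun_inv f : (forall x, 0 < f x) ->
  measurable_fun setT f -> measurable_fun setT (fun x => (f x)^-1).
Proof.
move=> f0 mf; rewrite (_ : (fun x => _) = (fun x => expR (- ln (f x)))).
  by do 2 apply: measurableT_comp => //; exact: measurableT_comp.
by apply/funext => x; rewrite expRN lnK// posrE.
Qed.

Lemma measurable_fun_sqrt f : measurable_fun setT f ->
  measurable_fun setT (fun x => Num.sqrt (f x)).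
Proof.
by apply: measurableT_comp; apply: continuous_measurable_fun; exact: sqrt_continuous.
Qed.

End positive_measurability.

(** * Mixing over the precision: marginal likelihoods as Bayes factors *)

Section mixture.
Variable R : realType.
Local Notation mu := (@lebesgue_measure R).

(* The identity on positive reals; the junk value 1 elsewhere keeps every
   formula in the precision positive and measurable on the whole line. *)
Definition pos_id (g : R) : R := expR (ln g).

(** Extension by zero, so that integrals over the precision run over the whole line. *)
Definition prec_dens (h : R -> R) (g : R) : R := if 0 < g then h g else 0.

(** The factor left by completing the square: at precision [g], the marginal likelihood divided by
    the likelihood at [phi = 0]. *)
Definition shrink (k S g : R) : R :=
  Num.sqrt (pos_id g / (pos_id g + k)) *
  expR (S ^+ 2 / (2 * (pos_id g + k))).

(* The Bayes factor against [phi = 0], as a function of the sample size [k] and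
   of the sum [S] of the observations. *)
Definition bayes_factor (h : R -> R) (k S : R) : \bar R :=
  (\int[mu]_g (prec_dens h g * shrink k S g)%:E)%E.

Lemma pos_id_gt0 g : 0 < pos_id g.
Proof. exact: expR_gt0. Qed.

Lemma pos_idE g : 0 < g -> pos_id g = g.
Proof. by move=> g0; rewrite /pos_id lnK// posrE. Qed.

Lemma measurable_pos_id : measurable_fun setT pos_id.
Proof. exact: measurableT_comp. Qed.

Lemma pos_idD_gt0 g k : 0 <= k -> 0 < pos_id g + k.
Proof. by move=> k0; have := pos_id_gt0 g; lra. Qed.

Lemma shrink_ge0 k S g : 0 <= shrink k S g.
Proof. by rewrite mulr_ge0 ?sqrtr_ge0 ?expR_ge0. Qed.

(** Joint measurability in the sum and the precision is what later makes the Bayes factor measurable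
    in the sum. *)
Lemma measurable_shrink2 k : 0 <= k ->
  measurable_fun setT (fun z : R * R => shrink k z.1 z.2).
Proof.
move=> k0.
have mD : measurable_fun setT (fun z : R * R => pos_id z.2 + k).
  apply: measurable_funD => //; apply: measurableT_comp => //.
  exact: measurable_pos_id.
apply: measurable_funM.
  apply: measurable_fun_sqrt; apply: measurable_funM.
    by apply: measurableT_comp => //; exact: measurable_pos_id.
  by apply: measurable_fun_inv => // z; exact: pos_idD_gt0.
apply: measurableT_comp => //; apply: measurable_funM.
  by apply: measurable_funX; exact: measurable_fst.
apply: measurable_fun_inv => [z|]; last exact: measurable_funM.
by rewrite mulr_gt0// pos_idD_gt0.
Qed.

Lemma measurable_shrink k S : 0 <= k -> measurable_fun setT (shrink k S).
Proof.
move=> k0.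
exact: (measurableT_comp (measurable_shrink2 k0) (pair1_measurable S)).
Qed.

Lemma measurable_gauss_prec :
  measurable_fun setT (fun z : R * R => gauss 0 (pos_id z.2)^-1 z.1).
Proof.
have mi : measurable_fun setT (fun z : R * R => (pos_id z.2)^-1).
  apply: measurable_fun_inv => [z|]; first exact: pos_id_gt0.
  by apply: measurableT_comp => //; exact: measurable_pos_id.
have i0 (z : R * R) : 0 < (pos_id z.2)^-1.
  by rewrite invr_gt0 pos_id_gt0.
apply: measurable_funM.
  apply: measurableT_comp => //; apply: measurable_funM.
    apply: measurable_funN; apply: measurable_funX.
    by apply: measurable_funB => //; exact: measurable_fst.
  apply: measurable_fun_inv => [z|]; first by rewrite mulr_gt0.
  exact: measurable_funM.
apply: measurable_fun_inv => [z|].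
  by rewrite sqrtr_gt0 !mulr_gt0 ?pi_gt0.
by apply: measurable_fun_sqrt; exact: measurable_funM.
Qed.

Lemma measurable_lik (s : seq R) : measurable_fun setT (lik s).
Proof.
rewrite (_ : lik s = fun x => lik s 0 *
    expR (x * \sum_(y <- s) y - (size s)%:R * x ^+ 2 / 2)); last first.
  by apply/funext => x; exact: lik_factor.
apply: measurable_funM => //; apply: measurableT_comp => //.
apply: measurable_funB; first exact: measurable_funM.
by apply: measurable_funM => //; apply: measurable_funM => //.
Qed.

Variable h : R -> R.
Hypothesis mh : measurable_fun setT (prec_dens h).
Hypothesis h_ge0 : forall g, 0 <= prec_dens h g.

Lemma prior_densE x : prior_dens h x =
  (\int[mu]_g (gauss 0 (pos_id g)^-1 x * prec_dens h g)%:E)%E.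
Proof.
rewrite /prior_dens integral_mkcond; apply: eq_integral => g _.
rewrite patchE /prec_dens; case: ifPn => [|].
  by rewrite inE/= => g0; rewrite g0 pos_idE.
by rewrite notin_setE/= => /negP/negbTE ->; rewrite mulr0.
Qed.

(** Tonelli exchanges [phi] and the precision; at a fixed precision the integrand in [phi] is then a
    multiple of a Gaussian density of mass one. *)
Lemma marginal_likelihoodE (s : seq R) :
  (\int[mu]_x ((lik s x)%:E * prior_dens h x) =
   (lik s 0)%:E * bayes_factor h (size s)%:R (\sum_(y <- s) y))%E.
Proof.
pose f (z : R * R) :=
  (lik s z.1 * (gauss 0 (pos_id z.2)^-1 z.1 * prec_dens h z.2))%:E.
have f0 z : (0 <= f z)%E.
  by rewrite lee_fin !mulr_ge0 ?gauss_ge0// ltW// lik_gt0.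
have mf : measurable_fun setT f.
  apply/measurable_EFinP; apply: measurable_funM.
    by apply: measurableT_comp => //; exact: measurable_lik.
  apply: measurable_funM; first exact: measurable_gauss_prec.
  by apply: measurableT_comp => //; exact: measurable_snd.
transitivity (\int[mu]_x \int[mu]_g f (x, g))%E.
  apply: eq_integral => x _; rewrite prior_densE -ge0_integralZl//.
  - apply/measurable_EFinP; apply: measurable_funM => //.
    exact: (measurableT_comp measurable_gauss_prec (pair1_measurable x)).
  - by move=> g _; rewrite lee_fin mulr_ge0// gauss_ge0.
  - by rewrite lee_fin ltW// lik_gt0.
rewrite fubini_tonelli// /bayes_factor -ge0_integralZl//; first last.
- by rewrite lee_fin ltW// lik_gt0.
- by move=> g _; rewrite lee_fin mulr_ge0// shrink_ge0.
- by apply/measurable_EFinP; apply: measurable_funM => //; exact: measurable_shrink.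
apply: eq_integral => g _.
set k := (size s)%:R; set S := \sum_(y <- s) y.
have gk0 : 0 < pos_id g + k by exact: pos_idD_gt0.
transitivity (\int[mu]_x ((lik s 0 * (prec_dens h g * shrink k S g))%:E *
    (gauss (S / (pos_id g + k)) (pos_id g + k)^-1 x)%:E))%E.
  apply: eq_integral => x _; rewrite /f /= -EFinM; congr EFin.
  have := @gauss_complete_square R (pos_id g) k S x (pos_id_gt0 g) (ler0n _ _).
  rewrite lik_factor -/k -/S -/(shrink k S g) => e.
  transitivity (lik s 0 * prec_dens h g * (expR (x * S - k * x ^+ 2 / 2) *
     gauss 0 (pos_id g)^-1 x)); first by ring.
  by rewrite e; ring.
rewrite integralZl//; last by apply: integrable_gauss; rewrite invr_gt0.
by rewrite integral_gauss ?invr_gt0// mule1 EFinM.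
Qed.

End mixture.

(** * Log Bayes factors and the telescoping of the cumulative risk *)

Section cumulative_risk.
Variable R : realType.
Local Notation mu := (@lebesgue_measure R).
Variable h : R -> R.
Hypothesis mh : measurable_fun setT (prec_dens h).
Hypothesis h_ge0 : forall g, 0 <= prec_dens h g.
Hypothesis h_fin : (\int[mu]_g (prec_dens h g)%:E < +oo)%E.
Hypothesis h_pos : forall n, (0 < n)%N -> (0 < bayes_factor h n%:R 0)%E.

Let shrink_integrand_ge0 (k S g : R) : (0 <= (prec_dens h g * shrink k S g)%:E)%E.
Proof. by rewrite lee_fin mulr_ge0// shrink_ge0. Qed.

Let measurable_shrink_integrand (k S : R) : 0 <= k ->
  measurable_fun setT (fun g => (prec_dens h g * shrink k S g)%:E).
Proof.
move=> k0; apply/measurable_EFinP; apply: measurable_funM => //.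
exact: measurable_shrink.
Qed.

Lemma bayes_factor_ge0 (k S : R) : (0 <= bayes_factor h k S)%E.
Proof. by apply: integral_ge0 => g _; exact: shrink_integrand_ge0. Qed.

Lemma bayes_factor00 :
  bayes_factor h 0 0 = (\int[mu]_g (prec_dens h g)%:E)%E.
Proof.
apply: eq_integral => g _; rewrite /shrink addr0 divff ?gt_eqF ?pos_id_gt0//.
by rewrite sqrtr1 expr0n/= mul0r expR0 !mulr1.
Qed.

(** For each precision the square root is at most 1, and lowering [pos_id g + k] to [k] only
    increases the exponential. This yields finiteness and the quadratic growth of the logarithm. *)
Lemma bayes_factor_le (k S : R) : 0 < k ->
  (bayes_factor h k S <=
   (expR (S ^+ 2 / (2 * k)))%:E * \int[mu]_g (prec_dens h g)%:E)%E.
Proof.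
move=> k0; rewrite -ge0_integralZl//; last 2 first.
- exact/measurable_EFinP.
- by move=> g _; rewrite lee_fin.
apply: ge0_le_integral => //.
- by apply: measurable_shrink_integrand; exact: ltW.
- by apply: emeasurable_funM => //; exact/measurable_EFinP.
move=> g _; rewrite -EFinM lee_fin mulrC ler_wpM2r//.
have e0 := pos_id_gt0 g; have ek0 := pos_idD_gt0 g (ltW k0).
rewrite /shrink -[leRHS]mul1r ler_pM ?sqrtr_ge0 ?expR_ge0//.
  rewrite -[leRHS]sqrtr1 ler_wsqrtr// ler_pdivrMr// mul1r; lra.
rewrite ler_expR ler_wpM2l ?sqr_ge0// lef_pV2 ?posrE ?mulr_gt0//; lra.
Qed.

(** For each precision the exponent is nonnegative and vanishes at [S = 0]. *)
Lemma bayes_factor_ge (k S : R) : 0 <= k ->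
  (bayes_factor h k 0 <= bayes_factor h k S)%E.
Proof.
move=> k0; apply: ge0_le_integral => //; try exact: measurable_shrink_integrand.
move=> g _; rewrite lee_fin !ler_wpM2l ?sqrtr_ge0// ler_expR.
rewrite expr0n/= mul0r mulr_ge0 ?sqr_ge0// invr_ge0 mulr_ge0//.
exact/ltW/pos_idD_gt0.
Qed.

Lemma bayes_factor_fin_num (k S : R) : 0 < k -> bayes_factor h k S \is a fin_num.
Proof.
move=> k0; rewrite ge0_fin_numE ?bayes_factor_ge0//.
apply: (le_lt_trans (bayes_factor_le S k0)).
by rewrite lte_mul_pinfty// ?lee_fin ?expR_ge0.
Qed.

Lemma bayes_factor00_fin_num : bayes_factor h 0 0 \is a fin_num.
Proof. by rewrite ge0_fin_numE ?bayes_factor_ge0// bayes_factor00. Qed.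

Lemma bayes_factor00_ge (k : R) : 0 < k ->
  (bayes_factor h k 0 <= bayes_factor h 0 0)%E.
Proof.
move=> k0; rewrite bayes_factor00; apply: (le_trans (bayes_factor_le _ k0)).
by rewrite expr0n/= mul0r expR0 mul1e.
Qed.

Lemma measurable_bayes_factor (k : R) : 0 <= k ->
  measurable_fun setT (bayes_factor h k).
Proof.
move=> k0; apply: (@measurable_fun_fubini_tonelli_F _ _ _ _ _ mu
  (fun z : R * R => (prec_dens h z.2 * shrink k z.1 z.2)%:E)).
  apply/measurable_EFinP; apply: measurable_funM.
    by apply: measurableT_comp => //; exact: measurable_snd.
  exact: measurable_shrink2.
by move=> z; exact: shrink_integrand_ge0.
Qed.

#[local] Opaque bayes_factor.

(* For n = 0 the only possible sum of observations is 0, and the Bayes factor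
   is infinite elsewhere. *)
Definition log_bf (n : nat) (S : R) : R :=
  ln (fine (bayes_factor h n%:R (if n == 0%N then 0 else S))).

(** The side condition rules out an empty sample with a nonzero sum, where finiteness may fail. *)
Lemma bayes_factor_fine (n : nat) S : (n = 0%N -> S = 0) ->
  bayes_factor h n%:R S = (fine (bayes_factor h n%:R S))%:E.
Proof.
case: n => [S0|n _]; rewrite fineK//.
- by rewrite S0// bayes_factor00_fin_num.
- by apply: bayes_factor_fin_num; rewrite ltr0n.
Qed.

Lemma fine_bayes_factor_gt0 (n : nat) S : (n = 0%N -> S = 0) ->
  0 < fine (bayes_factor h n%:R S).
Proof.
move=> n0S; rewrite -lte_fin -bayes_factor_fine//.
(* [h_pos] covers positive sizes only; the empty sample is compared with size one. *)
case: n n0S => [->//|n _].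
- have : (0 < bayes_factor h 1%:R 0)%E by exact: h_pos.
  by move=> /lt_le_trans; apply; exact: bayes_factor00_ge.
- by apply: (lt_le_trans (h_pos (ltn0Sn n))); exact: bayes_factor_ge.
Qed.

Lemma log_bfE n S : (n = 0%N -> S = 0) ->
  log_bf n S = ln (fine (bayes_factor h n%:R S)).
Proof. by case: n => [->|n _]; rewrite /log_bf. Qed.

Lemma log_bf_ge n S : log_bf n 0 <= log_bf n S.
Proof.
case: n => [|n]; first exact: lexx.
rewrite !log_bfE// ler_ln; try by rewrite posrE; exact: fine_bayes_factor_gt0.
rewrite -lee_fin -!bayes_factor_fine; try by move=> *.
exact: bayes_factor_ge.
Qed.

Lemma measurable_log_bf n : measurable_fun setT (log_bf n).
Proof.
case: n => [|n]; first exact: (measurable_cst (log_bf 0 0)).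
apply: measurableT_comp => //; apply: measurableT_comp => //=.
exact: measurable_bayes_factor.
Qed.

(** For [S >= 0], [expR S] is the square of [expR (S / 2) >= 1 + S / 2]; the other sign follows by
    symmetry. *)
Lemma sqr_le_cosh (S : R) : S ^+ 2 <= 4 * (expR S + expR (- S)).
Proof.
wlog S0 : S / 0 <= S.
  move=> H; have [|/ltW] := leP 0 S; first exact: H.
  by rewrite -oppr_ge0 => /H; rewrite sqrrN opprK addrC.
have -> : expR S = expR (S / 2) ^+ 2 by rewrite -expRM_natl; congr expR; field.
have e0 := expR_ge0 (- S); have := expR_ge1Dx (S / 2).
nra.
Qed.

(** Bounded below by the value at 0, and above by a quadratic through [bayes_factor_le]; the
    exponentials absorb both. *)
Lemma exp_growth_log_bf n : exp_growth (log_bf n).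
Proof.
split; first exact: measurable_log_bf.
case: n => [|n].
  by have [_] := exp_growth_cst (log_bf 0 0).
pose H := fine (bayes_factor h 0 0).
have H0 : 0 < H by exact: (@fine_bayes_factor_gt0 0 0).
have HE : (\int[mu]_g (prec_dens h g)%:E)%E = H%:E.
  by rewrite -bayes_factor00 fineK// bayes_factor00_fin_num.
have up S : log_bf n.+1 S <= S ^+ 2 + ln H.
  have n0 : 0 < n.+1%:R :> R by rewrite ltr0n.
  have w0 : 0 < fine (bayes_factor h n.+1%:R S) by exact: fine_bayes_factor_gt0.
  have r0 : 0 < expR (S ^+ 2) * H by apply: mulr_gt0 H0; exact: expR_gt0.
  rewrite -(expRK (S ^+ 2)) -lnM; [|by rewrite posrE expR_gt0|exact: H0].
  rewrite log_bfE; last by [].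
  rewrite ler_ln; [|exact: w0|exact: r0].
  rewrite -lee_fin -bayes_factor_fine//=; apply: (le_trans (bayes_factor_le _ n0)).
  rewrite HE -EFinM lee_fin; apply: ler_wpM2r; first exact: ltW.
  rewrite ler_expR.
  rewrite ler_pdivrMr ?mulr_gt0// ler_peMr ?sqr_ge0//.
  by rewrite -natrM ler1n.
(* [E] stands for the sum of the two exponentials; since [E >= 1] it absorbs the additive constants
   [b] and [c]. *)
have bound (v E b c l t r : R) : 0 <= b -> 0 <= c -> 1 <= E -> - b <= l ->
    t <= c -> r <= 4 * E -> l <= v -> v <= r + t -> `|v| <= (4 + c + b) * E.
  by move=> *; rewrite ler_norml; apply/andP; split; nra.
exists (4 + `|ln H| + `|log_bf n.+1 0|) => S.
apply: (bound _ _ _ _ _ _ _ _ _ _ _ _ _ (log_bf_ge _ S) (up S)) => //.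
- by have := expR_ge1Dx S; have := expR_ge1Dx (- S); lra.
- by rewrite lerNl -normrN ler_norm.
- exact: ler_norm.
- exact: sqr_le_cosh.
Qed.

(** Numerator and denominator are the marginal likelihoods of [y :: s] and of [s], and their common
    factor [lik s 0] cancels. *)
Lemma post_predE (s : seq R) y : post_pred h s y =
  gauss 0 1 y * (fine (bayes_factor h (size s).+1%:R (\sum_(x <- s) x + y)) /
                 fine (bayes_factor h (size s)%:R (\sum_(x <- s) x))).
Proof.
rewrite /post_pred.
have lik_cons x : gauss x 1 y * lik s x = lik (y :: s) x by rewrite /lik big_cons.
under eq_integral do rewrite lik_cons.
rewrite !marginal_likelihoodE// big_cons addrC /=.
rewrite (@bayes_factor_fine (size s)); last first.
  by move/size0nil ->; rewrite big_nil.
rewrite (@bayes_factor_fine (size s).+1)// -!EFinM /=.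
rewrite {1}/lik big_cons -/(lik s 0).
have simpl (b l u v : R) : 0 < l -> b * l * u / (l * v) = b * (u / v).
  move=> l0; rewrite invfM -!mulrA; congr (b * _).
  by rewrite [u * _]mulrCA mulVKf// gt_eqF.
apply: simpl; exact: lik_gt0.
Qed.

(** The Gaussian density cancels inside the logarithm, leaving log Bayes factors at [S] and at
    [S + y]; averaging over [y] is [smooth]. *)
Lemma KL_post_pred (s : seq R) : KL (gauss 0 1) (post_pred h s) =
  (log_bf (size s) (\sum_(x <- s) x) -
   smooth (log_bf (size s).+1) (\sum_(x <- s) x))%:E.
Proof.
set S := \sum_(x <- s) x; set n := size s.
have n0S : n = 0%N -> S = 0 by rewrite /S => /size0nil ->; rewrite big_nil.
have cF : exp_growth (cst (log_bf n S)) by exact: exp_growth_cst.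
have gF := exp_growth_log_bf n.+1.
(* The term free of [y] is written as the average of a constant, which puts both terms under one
   integral. *)
rewrite -[log_bf n S](smooth_cst (log_bf n S) S) -smoothB//.
rewrite -smoothE; last exact: exp_growthB.
apply: eq_integral => y _; congr (_ * _)%:E; rewrite post_predE -/S -/n.
have w1 : 0 < fine (bayes_factor h n.+1%:R (S + y)) by exact: fine_bayes_factor_gt0.
have w0 : 0 < fine (bayes_factor h n%:R S) by exact: fine_bayes_factor_gt0.
have log_ratio (b u v : R) : 0 < b -> 0 < u -> 0 < v ->
    ln (b / (b * (u / v))) = ln v - ln u.
  move=> b0 u0 v0; rewrite invfM mulrA divff ?gt_eqF// mul1r invf_div.
  by rewrite ln_div ?posrE.
rewrite (log_ratio _ _ _ (gauss_gt0 _ _ ltr01) w1 w0).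
by rewrite -(log_bfE n0S) -[ln _](@log_bfE n.+1 (S + y)).
Qed.

Lemma cumulative_risk_le n :
  (\sum_(j < n) iid_exp 0 j (fun s => KL (gauss 0 1) (post_pred h s)) <=
   (log_bf 0 0 - log_bf n 0)%:E)%E.
Proof.
have -> : (\sum_(j < n) iid_exp 0 j (fun s => KL (gauss 0 1) (post_pred h s)) =
    (log_bf 0 0 - iter n (@smooth R) (log_bf n) 0)%:E)%E.
  elim: n => [|n IH]; first by rewrite big_ord0 subrr.
  rewrite big_ord_recr /= IH.
  pose F S := log_bf n S - smooth (log_bf n.+1) S.
  have gs : exp_growth (smooth (log_bf n.+1)).
    exact/exp_growth_smooth/exp_growth_log_bf.
  have gF : exp_growth F by apply: exp_growthB => //; exact: exp_growth_log_bf.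
  rewrite (_ : iid_exp 0 n _ = (iter n (@smooth R) F 0)%:E); last first.
    rewrite -iid_exp_sum//; apply: iid_exp_eq => s sn.
    by rewrite KL_post_pred sn add0r.
  rewrite iter_smoothB//; last exact: exp_growth_log_bf.
  (* Averaging once and then [n] times is averaging [n.+1] times, so the two middle terms cancel. *)
  by rewrite -EFinD -iterSr iterS; congr EFin; ring.
(* The remaining mean is at least the minimum of [log_bf n], attained at sum 0. *)
rewrite lee_fin lerB//; apply: iter_smooth_ge; first exact: exp_growth_log_bf.
by move=> x; exact: log_bf_ge.
Qed.

End cumulative_risk.

(** * Precisions whose logarithm is Cauchy: total mass and lower bound on the Bayes factor *)

Section log_cauchy_density.
Variable R : realType.
Local Notation mu := (@lebesgue_measure R).
Variables c q : R.
Hypotheses (c_gt0 : 0 < c) (q_gt0 : 0 < q).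
Variable h : R -> R.
Hypothesis hE : forall g, 0 < g -> h g = c / (g * (ln g ^+ 2 + q)).

Let denom_gt0 (g : R) : 0 < ln g ^+ 2 + q.
Proof. by rewrite ltr_wpDl// sqr_ge0. Qed.

Let dens_gt0 (g : R) : 0 < g -> 0 < c / (g * (ln g ^+ 2 + q)).
Proof. by move=> g0; rewrite divr_gt0// mulr_gt0. Qed.

Lemma prec_dens_ge0 g : 0 <= prec_dens h g.
Proof. by rewrite /prec_dens; case: ifPn => // g0; rewrite hE// ltW// dens_gt0. Qed.

Lemma measurable_prec_dens : measurable_fun setT (prec_dens h).
Proof.
rewrite (_ : prec_dens h = fun g => \1_`]0, +oo[ g *
    (c * (pos_id g * (ln g ^+ 2 + q))^-1)); last first.
  apply/funext => g; rewrite /prec_dens indicE.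
  have [g0|g0] := ltP 0 g.
    by rewrite mem_set/= ?in_itv/= ?g0// mul1r pos_idE// hE.
  by rewrite memNset/= ?mul0r// in_itv/= andbT ltNge g0.
apply: measurable_funM => //; apply: measurable_funM => //.
apply: measurable_fun_inv => [g|]; first by rewrite mulr_gt0// pos_id_gt0.
apply: measurable_funM; first exact: measurable_pos_id.
by apply: measurable_funD => //; apply: measurable_funX.
Qed.

(** Up to affine normalisation, the distribution function of a variable whose logarithm is Cauchy of
    scale [Num.sqrt q]. *)
Let cdf (x : R) : R := c / Num.sqrt q * atan (ln x / Num.sqrt q).

Let is_derive_cdf (x : R) : 0 < x ->
  is_derive x 1 cdf (c / (x * (ln x ^+ 2 + q))).
Proof.
move=> x0; have s0 : 0 < Num.sqrt q by rewrite sqrtr_gt0.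
have dl : is_derive x 1 (fun y => ln y / Num.sqrt q) (x^-1 / Num.sqrt q).
  rewrite (_ : (fun y => _) = (Num.sqrt q)^-1 *: (@ln R)); last first.
    by apply/funext => y; rewrite /= mulrC.
  rewrite mulrC; apply: is_deriveZ; exact: is_derive1_ln.
have da := @is_derive1_comp R _ _ x _ _ (is_derive1_atan (ln x / Num.sqrt q)) dl.
have -> : cdf = (c / Num.sqrt q) *: (atan \o (fun y => ln y / Num.sqrt q)).
  by apply/funext.
apply: (is_derive_eq (is_deriveZ _ da)); rewrite /GRing.scale /=.
have simpl (s l : R) : 0 < s ->
    c / s * ((1 + (l / s) ^+ 2)^-1 * (x^-1 / s)) = c / (x * (l ^+ 2 + s ^+ 2)).
  move=> s1; field; rewrite !gt_eqF//=.
  by have := sqr_ge0 l; have := mulr_gt0 s1 s1; rewrite -expr2; lra.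
by have := simpl _ (ln x) s0; rewrite (sqr_sqrtr (ltW q_gt0)) => <-.
Qed.

(** [atan] varies by less than [pi], so the bound is uniform in the interval. *)
Let integral_dens_itv (u v : R) : 0 < u -> u < v ->
  (\int[mu]_(x in `[u, v]) (c / (x * (ln x ^+ 2 + q)))%:E <=
   (c / Num.sqrt q * pi)%:E)%E.
Proof.
move=> u0 uv; have v0 := lt_trans u0 uv.
have ccdf (x : R) : 0 < x -> {for x, continuous cdf}.
  move=> x0; apply: differentiable_continuous; apply/derivable1_diffP.
  by have [] := is_derive_cdf x0.
rewrite (@continuous_FTC2 R _ cdf)//.
- rewrite -EFinB lee_fin /cdf -mulrBr ler_wpM2l ?divr_ge0 ?sqrtr_ge0 ?ltW//.
  have := atan_ltpi2 (ln v / Num.sqrt q); have := atan_gtNpi2 (ln u / Num.sqrt q).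
  by move: (atan _) (atan _) (pi : R) => x y p; lra.
- apply: continuous_in_subspaceT => x; rewrite inE/= in_itv/= => /andP[ux _].
  have x0 := lt_le_trans u0 ux.
  apply: cvgM; first exact: cvg_cst.
  apply: cvgV; first by rewrite gt_eqF// mulr_gt0.
  apply: cvgM; first exact: cvg_id.
  apply: cvgD; last exact: cvg_cst.
  by rewrite expr2; apply: cvgM; exact: continuous_ln.
- split.
  + move=> x; rewrite in_itv/= => /andP[ux _].
    by have [] := is_derive_cdf (lt_trans u0 ux).
  + by apply: cvg_at_right_filter; exact: ccdf.
  + by apply: cvg_at_left_filter; exact: ccdf.
- move=> x; rewrite in_itv/= => /andP[ux _]; rewrite derive1E.
  by have [_ ->] := is_derive_cdf (lt_trans u0 ux).
Qed.

Lemma prec_dens_integral_lty : (\int[mu]_g (prec_dens h g)%:E < +oo)%E.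
Proof.
(* Compact intervals exhaust the positive half-line; the shift by 2 keeps the endpoints distinct
   already at [n = 0]. *)
pose F (n : nat) := [set` `[(n%:R + 2)^-1 : R, n%:R + 2]].
have n2_gt0 (n : nat) : 0 < n%:R + 2 :> R by rewrite ltr_wpDl.
have F0 n x : F n x -> 0 < x.
  rewrite /F /= in_itv/= => /andP[+ _]; apply: lt_le_trans.
  by rewrite invr_gt0.
have -> : (\int[mu]_g (prec_dens h g)%:E =
    \int[mu]_(g in \bigcup_n F n) (prec_dens h g)%:E)%E.
  rewrite [RHS]integral_mkcond; apply: eq_integral => g _; rewrite patchE.
  case: ifPn => //; rewrite notin_setE => nF; rewrite /prec_dens.
  case: ifPn => // g0; exfalso; apply: nF.
  (* This [m] makes [m + 2] exceed both [g] and [g^-1]. *)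
  pose m := Num.truncn (g + g^-1); exists m => //.
  have gm : g + g^-1 < m.+1%:R by exact: truncnS_gt.
  have i0 : 0 < g^-1 by rewrite invr_gt0.
  rewrite /F /= in_itv/=; move: gm; rewrite -natr1 => gm; apply/andP; split; last lra.
  rewrite -[leRHS]invrK lef_pV2 ?posrE//.
  lra.
apply: (@le_lt_trans _ _ (c / Num.sqrt q * pi)%:E); last exact: ltry.
apply: cvge_le; last first.
  apply: ge0_nondecreasing_set_cvg_integral.
  - apply/nondecreasing_seqP => n; rewrite subsetEset; apply: subset_itv.
      by rewrite bnd_simp lef_pV2 ?posrE// lerD2r ler_nat.
    by rewrite bnd_simp lerD2r ler_nat.
  - by move=> n; exact: measurable_itv.
  - by move=> n; apply/measurable_EFinP/measurable_funTS; exact: measurable_prec_dens.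
  - by move=> n x _; rewrite lee_fin prec_dens_ge0.
apply: nearW => n.
rewrite (_ : (\int[mu]_(x in F n) _)%E =
    (\int[mu]_(x in F n) (c / (x * (ln x ^+ 2 + q)))%:E)%E).
  apply: integral_dens_itv; first by rewrite invr_gt0.
  have n2 : 1 < n%:R + 2 :> R by rewrite ltr_wpDl// ltr1n.
  by apply: (@lt_trans _ _ 1) => //; rewrite invf_lt1// (lt_trans _ n2).
  apply: eq_integral => x; rewrite inE => /F0 x0.
  by rewrite /prec_dens x0 hE.
exact: eventually_filter.
Qed.

(** With [L = ln (2 * n%:R) ^+ 2 + q], on the interval from [n] to [2 n] of length [n] the density
    is at least [c / (2 * n%:R * L)] and [shrink] at least one half. *)
Lemma bayes_factor0_ge (n : nat) : (0 < n)%N ->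
  ((c / (4 * (ln (2 * n%:R) ^+ 2 + q)))%:E <= bayes_factor h n%:R 0)%E.
Proof.
move=> n0; have n1 : 1 <= n%:R :> R by rewrite ler1n.
pose L := ln (2 * n%:R) ^+ 2 + q.
have L0 : 0 < L by exact: denom_gt0.
pose I : set R := [set` `[n%:R : R, 2 * n%:R]].
have mI : measurable I by exact: measurable_itv.
have f0 g : (0 <= (prec_dens h g * shrink n%:R 0 g)%:E)%E.
  by rewrite lee_fin mulr_ge0 ?prec_dens_ge0 ?shrink_ge0.
have mf : measurable_fun setT (fun g => (prec_dens h g * shrink n%:R 0 g)%:E).
  apply/measurable_EFinP; apply: measurable_funM; first exact: measurable_prec_dens.
  exact: measurable_shrink.
apply: (@le_trans _ _ (\int[mu]_(g in I)
    (prec_dens h g * shrink n%:R 0 g)%:E)%E); last first.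
  exact: ge0_subset_integral.
apply: (@le_trans _ _ (\int[mu]_(g in I)
    (c / (2 * n%:R * L) * 2^-1)%:E)%E).
  rewrite integral_cst//= lebesgue_measure_itv/= lte_fin.
  rewrite ifT; last by lra.
  rewrite -EFinB -EFinM lee_fin le_eqVlt; apply/orP; left; apply/eqP.
  by rewrite -/L; field; rewrite !gt_eqF//; lra.
apply: ge0_le_integral => //.
- by move=> g _; rewrite lee_fin !mulr_ge0 ?invr_ge0 ?mulr_ge0 ?ltW//; lra.
- exact: measurable_funTS.
move=> g; rewrite /I /= in_itv/= => /andP[ng gn].
have g0 : 0 < g by lra.
rewrite lee_fin /prec_dens g0 hE// ler_pM//.
- by rewrite divr_ge0 ?mulr_ge0 ?ltW//; lra.
- rewrite ler_pM2l// lef_pV2 ?posrE ?mulr_gt0//; last lra.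
  apply: ler_pM => //; [exact: ltW|exact: ltW|].
  rewrite lerD2r ler_pXn2r ?nnegrE ?ln_ge0//; try lra.
  by rewrite ler_ln ?posrE//; lra.
rewrite /shrink pos_idE// expr0n/= mul0r expR0 mulr1.
(* It remains to see that [g / (g + n%:R)] is at least one quarter, which follows from
   [n%:R <= g]. *)
have -> : 2^-1 = Num.sqrt (2^-1 ^+ 2) :> R by rewrite sqrtr_sqr ger0_norm ?invr_ge0.
rewrite ler_wsqrtr// ler_pdivlMr; last lra.
by rewrite expr2; lra.
Qed.

End log_cauchy_density.

(** * Squared logarithms against powers of [n], and the risk bound *)

Section final_bound.
Variable R : realType.

(* [1 + x <= expR x] at [x = a ln n / 2], squared. *)
Lemma ln_sqr_le_expR (q a : R) : 0 < q -> 0 < a -> forall n, (0 < n)%N ->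
  ln (2 * n%:R) ^+ 2 + q <= (1 + q) * (1 + 2 / a) ^+ 2 * expR (a * ln n%:R).
Proof.
move=> q0 a0 n n0; have n1 : 1 <= n%:R :> R by rewrite ler1n.
have L0 : 0 <= ln n%:R :> R by rewrite ln_ge0.
have E1 := expR_ge1Dx (a * ln n%:R / 2).
have -> : expR (a * ln n%:R) = expR (a * ln n%:R / 2) ^+ 2.
  by rewrite -expRM_natl; congr expR; field.
have lE : ln (2 * n%:R) = ln 2 + ln n%:R :> R by rewrite lnM ?posrE//; lra.
have e2 : (2 : R) = 1 + 1 by [].
have ln2_le1 : ln (2 : R) <= 1 by rewrite e2; apply: le_ln1Dx; lra.
have ln2_ge0 : 0 <= ln (2 : R) by apply: ln_ge0; lra.
have l0 : 0 <= ln (2 * n%:R : R) by rewrite lE; lra.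
have l1 : ln (2 * n%:R : R) <= 1 + ln n%:R by rewrite lE; lra.
move: L0 E1 l0 l1; set L := ln n%:R; set E := expR _; set l := ln (2 * _).
move=> L0 E1 l0 l1.
have M0 : 0 < 2 / a by rewrite divr_gt0.
(* The cross term [2 / a * (a * L / 2)] of the expanded product is exactly [L]. *)
have LE : 1 + L <= (1 + 2 / a) * E.
  apply: (@le_trans _ _ ((1 + 2 / a) * (1 + a * L / 2))).
    rewrite [leRHS](_ : _ = 1 + L + 2 / a + a * L / 2); last by field; rewrite gt_eqF.
    by have := mulr_ge0 (ltW a0) L0; lra.
  by rewrite ler_wpM2l//; lra.
have LE2 : (1 + L) ^+ 2 <= ((1 + 2 / a) * E) ^+ 2.
  by rewrite ler_pXn2r ?nnegrE//; lra.
have ll : l ^+ 2 <= (1 + L) ^+ 2 by rewrite ler_pXn2r ?nnegrE//; lra.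
apply: (@le_trans _ _ ((1 + q) * (1 + L) ^+ 2)); first by nra.
by rewrite -mulrA -exprMn ler_wpM2l//; lra.
Qed.

(** The Bayes factor at 0 is at least a constant times the power [-a] of [n]; its logarithm yields
    [a * ln n%:R], and [K] gathers the terms free of [n]. *)
Lemma cesaro_risk_le (c q : R) (h : R -> R) (a : R) : 0 < c -> 0 < q ->
  (forall g, 0 < g -> h g = c / (g * (ln g ^+ 2 + q))) -> 0 < a ->
  exists K : R, forall n, (0 < n)%N ->
    (cesaro_risk h 0 n <= (n%:R^-1 * (a * ln n%:R + K))%:E)%E.
Proof.
move=> c0 q0 hE a0.
have mh := measurable_prec_dens q0 hE.
have h0 := prec_dens_ge0 c0 q0 hE.
have hfin := prec_dens_integral_lty c0 q0 hE.
have hlow := bayes_factor0_ge c0 q0 hE.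
have dpos n : 0 < c / (4 * (ln (2 * n%:R) ^+ 2 + q)).
  by rewrite divr_gt0// mulr_gt0// ltr_wpDl// sqr_ge0.
have hpos n : (0 < n)%N -> (0 < bayes_factor h n%:R 0)%E.
  by move=> n0; apply: lt_le_trans (hlow n n0); rewrite lte_fin.
pose M := (1 + q) * (1 + 2 / a) ^+ 2.
have M0 : 0 < M.
  by rewrite mulr_gt0 ?exprn_gt0// ?addr_gt0// divr_gt0.
(* Replacing the squared logarithm in [hlow] by [M * expR (a * ln n%:R)] leaves [B] as the constant
   factor. *)
pose B := c / (4 * M); have B0 : 0 < B by rewrite divr_gt0// mulr_gt0.
exists (log_bf h 0 0 - ln B) => n n0.
rewrite /cesaro_risk EFinM; apply: lee_wpmul2l.
  by rewrite lee_fin invr_ge0.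
apply: (le_trans (cumulative_risk_le mh h0 hfin hpos n)).
rewrite lee_fin.
suff low : ln B - a * ln n%:R <= log_bf h n 0 by move: low; lra.
rewrite log_bfE// -[a * _]expRK -ln_div ?posrE ?expR_gt0//.
have w0 : 0 < fine (bayes_factor h n%:R 0) by exact: fine_bayes_factor_gt0.
have BE0 : 0 < B / expR (a * ln n%:R) by apply: divr_gt0 => //; exact: expR_gt0.
rewrite ler_ln ?posrE//.
rewrite -lee_fin -bayes_factor_fine//; apply: le_trans (hlow n n0).
rewrite lee_fin /B -mulrA -invfM ler_pM2l// lef_pV2 ?posrE; last 2 first.
- by rewrite mulr_gt0 ?expR_gt0// mulr_gt0.
- by rewrite mulr_gt0// ltr_wpDl// sqr_ge0.
by rewrite -mulrA ler_pM2l// ln_sqr_le_expR.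
Qed.

End final_bound.

Theorem theorem3 (R : realType) (h : R -> R)
  (Hh : h = @hths_dens R \/ h = @hthsp_dens R) (a : R) (Ha : 0 < a) :
  exists C : R, 0 < C /\
    forall n : nat, (0 < n)%N ->
      (cesaro_risk h 0 n <=
       (a * ln (n%:R) / n%:R + n%:R^-1 * (1 + 1 / (a * C)))%:E)%E.
Proof.
have [K HK] : exists K : R, forall n, (0 < n)%N ->
    (cesaro_risk h 0 n <= (n%:R^-1 * (a * ln n%:R + K))%:E)%E.
  have pi20 : 0 < pi ^+ 2 :> R by rewrite exprn_gt0// pi_gt0.
  case: Hh => ->.
    exact: (@cesaro_risk_le R 1 (pi ^+ 2)).
  by apply: (@cesaro_risk_le R 2 (4 * pi ^+ 2)) => //; rewrite mulr_gt0.
(* [C] is chosen so that [1 / (a * C)] equals this quantity, which dominates [K] and is positive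
   whatever the sign of [K]. *)
have K0 : 0 < `|K| + 1 by rewrite ltr_wpDl.
exists (a * (`|K| + 1))^-1; split; first by rewrite invr_gt0 mulr_gt0.
move=> n n0; apply: (le_trans (HK n n0)); rewrite lee_fin.
have -> : 1 / (a * (a * (`|K| + 1))^-1) = `|K| + 1.
  by rewrite mul1r invfM invrK mulKf// gt_eqF.
rewrite [a * _ / _]mulrC -mulrDr ler_wpM2l ?invr_ge0//.
by have := ler_norm K; lra.
Qed.
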